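(* Let $\omega=e^{2\pi i/3}$. A complex $3\times3$ matrix $A$ belongs to $U(3)$ if and only if $$A=\frac16\begin{bmatrix}\lambda_1&0&0\\0&\lambda_2&0\\0&0&\lambda_3\end{bmatrix}\begin{bmatrix}1&1&1\\1&\overline\omega&\omega\\1&\omega&\overline\omega\end{bmatrix}\begin{bmatrix}2&0&0\\0&a(1+z)&ac(1-z)\\0&b(1-z)&bc(1+z)\end{bmatrix}\begin{bmatrix}1&1&1\\1&\omega&\overline\omega\\1&\overline\omega&\omega\end{bmatrix}\begin{bmatrix}1&0&0\\0&\lambda_4&0\\0&0&\lambda_5\end{bmatrix}$$ for some parameters $a,b,c,z,\lambda_1,\dots,\lambda_5\in\mathbb{T}$.
   Context: $\mathbb{T}=\{z\in\mathbb{C}:|z|=1\}$. *)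

(* Defs.v *)
From mathcomp Require Import all_boot all_order all_algebra.
From mathcomp Require Import reals sequences exp trigo.
From mathcomp Require Import complex.

Set Implicit Arguments.
Unset Strict Implicit.
Unset Printing Implicit Defensive.

Import Order.TTheory GRing.Theory Num.Theory.

Local Open Scope ring_scope.
Local Open Scope complex_scope.

(* The complex numbers are R[i], for an arbitrary model R of the reals. *)

Definition cexp (R : realType) (z : R[i]) : R[i] :=
  let: x +i* y := z in (expR x * cos y) +i* (expR x * sin y).

Definition omega (R : realType) : R[i] := cexp (2 * pi%:C * 'i / 3).

Definition unit_circle (R : realType) : {pred R[i]} :=
  [pred z : R[i] | `|z| == 1].
Arguments unit_circle R : clear implicits.

(* The 3 x 3 matrix whose rows are listed in s, from top to bottom. *)
Definition mx3 (R : realType) (s : seq (seq R[i])) : 'M[R[i]]_3 :=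
  \matrix_(i < 3, j < 3) nth 0 (nth [::] s i) j.

(* Main.v *)
(* Some diagonal unitaries turn a 3 x 3 unitary U into one fixing the all-ones
   vector; conjugating by the Fourier matrix then leaves a 2 x 2 unitary block,
   which a, b, c, z parametrise. Such diagonals exist as soon as U (1, x, y) has
   unimodular entries for some x, y on the circle, i.e. |a_i + b_i x + e_i y| = 1
   for the first two rows. For fixed x these are two real-linear equations in y,
   solved by Cramer's rule as y = N(x) / D(x), N and D Laurent polynomials in x.
   When the column playing the role of e maximises the coefficient of D, the
   average of |N|^2 - |D|^2 over {x, x w, x w^2} is nonpositive for a suitable x,
   so some x gives a solution y in the closed unit disc. Move x along an arc to a
   zero of D, where the two lines become parallel: either y meets the circle on
   the way, or it stays in the disc and the limiting common line meets the circle.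
   If instead D vanishes identically for all three columns, averaging over the
   three points shows directly that the common line meets the circle. *)

Require Import Defs.
From mathcomp Require Import all_boot all_order all_algebra.
From mathcomp Require Import reals sequences exp trigo.
From mathcomp Require Import complex.
From mathcomp Require Import boolp topology normedtype realfun.
From mathcomp Require Import ring lra.

Set Implicit Arguments.
Unset Strict Implicit.
Unset Printing Implicit Defensive.

Import Order.TTheory GRing.Theory Num.Theory.
Import numFieldNormedType.Exports.

Local Open Scope ring_scope.

(** * Squared moduli, the unit circle and polar form *)

Section SquaredModulus.
Variable R : realType.
Implicit Types z w x y u m : R[i].

(** Real-valued, whereas [|z|] lies in [R[i]], so that real order arguments and the intermediate
    value theorem apply. *)
Definition sqnorm z : R := complex.Re z ^+ 2 + complex.Im z ^+ 2.

Lemma conjE z : z^* = Complex (complex.Re z) (- complex.Im z).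
Proof. by case: z. Qed.

Lemma sqnormC z : (sqnorm z)%:C%C = z * z^*.
Proof.
by rewrite conjE; case: z => a b; apply/eqP; rewrite eq_complex /sqnorm /=;
  apply/andP; split; apply/eqP; ring.
Qed.

Lemma sqnormP z (r : R) : z * z^* = r%:C%C <-> sqnorm z = r.
Proof. by rewrite -sqnormC; split=> [/complexI|->]. Qed.

Lemma sqnorm_ge0 z : 0 <= sqnorm z.
Proof. by rewrite addr_ge0 ?sqr_ge0. Qed.

Lemma sqnorm_eq0 z : (sqnorm z == 0) = (z == 0).
Proof. by rewrite paddr_eq0 ?sqr_ge0// !sqrf_eq0 eq_complex. Qed.

Lemma sqnormM z w : sqnorm (z * w) = sqnorm z * sqnorm w.
Proof. by case: z w => [a b] [c d]; rewrite /sqnorm /=; ring. Qed.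

Lemma sqnormN z : sqnorm (- z) = sqnorm z.
Proof. by case: z => [a b]; rewrite /sqnorm /=; ring. Qed.

Lemma sqnorm_conj z : sqnorm z^* = sqnorm z.
Proof. by rewrite conjE; case: z => [a b]; rewrite /sqnorm /=; ring. Qed.

Lemma sqnorm_real (r : R) : sqnorm r%:C%C = r ^+ 2.
Proof. by rewrite /sqnorm /= expr0n addr0. Qed.

Lemma sqnorm0 : sqnorm 0 = 0.
Proof. by apply/eqP; rewrite sqnorm_eq0. Qed.

Lemma unit_circleP z : reflect (z * z^* = 1) (z \in unit_circle R).
Proof.
rewrite inE -normCK; apply: (iffP eqP) => [->|/eqP]; first by rewrite expr1n.
by rewrite sqrp_eq1 // => /eqP.
Qed.

Lemma unit_circle_sqnorm z : (z \in unit_circle R) = (sqnorm z == 1).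
Proof.
by apply/unit_circleP/eqP => [/(sqnormP z 1)|/(sqnormP z 1)].
Qed.

Lemma unit_circleM x y :
  x \in unit_circle R -> y \in unit_circle R -> x * y \in unit_circle R.
Proof. by rewrite !inE normrM => /eqP-> /eqP->; rewrite mulr1. Qed.

Lemma unit_circle_conj x : (x^* \in unit_circle R) = (x \in unit_circle R).
Proof. by rewrite !inE norm_conjC. Qed.

Lemma unit_circleN x : (- x \in unit_circle R) = (x \in unit_circle R).
Proof. by rewrite !inE normrN. Qed.

Lemma unit_circle1 : 1 \in unit_circle R.
Proof. by rewrite inE normr1. Qed.

Lemma polar z : exists2 u, u \in unit_circle R & z = (Num.sqrt (sqnorm z))%:C%C * u.
Proof.
have [->|z0] := eqVneq z 0.
  by exists 1; rewrite ?unit_circle1// sqnorm0 sqrtr0 mul0r.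
have s0 : 0 < sqnorm z by rewrite lt_def sqnorm_eq0 z0 sqnorm_ge0.
have r0 : (Num.sqrt (sqnorm z))%:C%C != 0.
  by rewrite (inj_eq (@complexI R) _ 0) gt_eqF// sqrtr_gt0.
exists (z / (Num.sqrt (sqnorm z))%:C%C); last by rewrite mulrC divfK.
rewrite unit_circle_sqnorm sqnormM -fmorphV sqnorm_real exprVn.
by rewrite sqr_sqrtr ?sqnorm_ge0// divff// gt_eqF.
Qed.

Lemma cube_root_unit_circle u :
  u \in unit_circle R -> exists2 x, x \in unit_circle R & x ^+ 3 = u.
Proof.
rewrite !inE => /eqP u1; exists (3.-root u); last by rewrite rootCK.
by rewrite inE norm_rootC u1 rootC1.
Qed.

(** On the circle x^2 = x^3 conj(x), so the sum is (p x^3 + q) conj(x). With u, v the phases of p,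
    q, a cube root x of - v conj(u) makes p x^3 and q point in opposite directions. *)
Lemma pair_alignment (p q : R[i]) : exists2 x, x \in unit_circle R &
  sqnorm (p * x ^+ 2 + q * x^*)
    = (Num.sqrt (sqnorm p) - Num.sqrt (sqnorm q)) ^+ 2.
Proof.
have [u uT ep] := polar p; have [v vT eq] := polar q.
set rp := Num.sqrt _ in ep *; set rq := Num.sqrt _ in eq *.
have [x xT x3] : exists2 x, x \in unit_circle R & x ^+ 3 = - (v * u^*).
  apply: cube_root_unit_circle.
  by rewrite unit_circleN unit_circleM// unit_circle_conj.
exists x => //.
have /unit_circleP xx := xT; have /unit_circleP uu := uT.
have -> : p * x ^+ 2 + q * x^* = (rq - rp)%:C%C * (v * x^*).
  rewrite [X in X * _ + _]ep [X in _ + X * _]eq rmorphB /=.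
  have -> : x ^+ 2 = x ^+ 3 * x^* by rewrite [x ^+ 3]exprSr -mulrA xx mulr1.
  rewrite x3.
  have -> : rp%:C%C * u * (- (v * u^*) * x^*) = - rp%:C%C * (u * u^*) * v * x^*.
    by ring.
  by rewrite uu; ring.
rewrite sqnormM sqnorm_real [sqnorm (v * _)]sqnormM sqnorm_conj.
move: xT vT; rewrite !unit_circle_sqnorm => /eqP-> /eqP->.
by ring.
Qed.

End SquaredModulus.

(** * Unimodularity of a row as a real line in y, and Cramer's rule for two rows *)

Section TwoRows.
Variable R : realType.
Implicit Types a b e x y z m : R[i].

(** For unimodular x, y: |a + b x + e y|^2 = |a|^2 + |b|^2 + |e|^2 + [cross] + 2 Re([slope]
    conj(y)). *)
Definition cross a b x : R := 2 * complex.Re (a^* * b * x).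
Definition slope a b e x : R[i] := e^* * (a + b * x).

(* For unimodular x, y and a unit row this says |a + b x + e y| = 1. *)
Definition balanced a b e x y :=
  (cross a b x)%:C%C + slope a b e x * y^* + (slope a b e x)^* * y = 0.

Lemma addcJ_Re z : z + z^* = (2 * complex.Re z)%:C%C.
Proof.
by rewrite conjE; case: z => u v; apply/eqP; rewrite eq_complex /=;
  apply/andP; split; apply/eqP; ring.
Qed.

Lemma crossC a b x : (cross a b x)%:C%C = a^* * b * x + a * b^* * x^*.
Proof. by rewrite -addcJ_Re !rmorphM /= conjCK. Qed.

Lemma balanced_norm a b e x y :
  x \in unit_circle R -> y \in unit_circle R ->
  a * a^* + b * b^* + e * e^* = 1 -> balanced a b e x y ->
  a + b * x + e * y \in unit_circle R.
Proof.
move=> /unit_circleP xx /unit_circleP yy n1 bal; apply/unit_circleP.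
rewrite -[RHS]addr0 -n1 -[X in _ = _ + X]bal crossC /slope.
rewrite !(rmorphM, rmorphD) /= !conjCK.
have e1 : b * b^* = b * b^* * (x * x^*) by rewrite xx mulr1.
have e2 : e * e^* = e * e^* * (y * y^*) by rewrite yy mulr1.
by rewrite e1 e2; ring.
Qed.

(** The line lies at distance |c| / (2|m|) <= 1 from the origin. With m = r u, |u| = 1 and y = u v,
    its equation becomes Re v = - c / (2 r). *)
Lemma real_line_meets_circle (c : R) m :
  m != 0 -> c ^+ 2 <= 4 * sqnorm m ->
  exists2 y, y \in unit_circle R & c%:C%C + m * y^* + m^* * y = 0.
Proof.
move=> m0 cm; have [u uT em] := polar m.
set r := Num.sqrt _ in em.
have s0 : 0 < sqnorm m by rewrite lt_def sqnorm_eq0 m0 sqnorm_ge0.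
have r0 : 0 < r by rewrite sqrtr_gt0.
have rr : r ^+ 2 = sqnorm m by rewrite sqr_sqrtr ?ltW.
set s : R := - c / (2 * r); set t := Num.sqrt (1 - s ^+ 2).
have tt : t ^+ 2 = 1 - s ^+ 2.
  rewrite sqr_sqrtr// /s expr_div_n sqrrN subr_ge0 ler_pdivrMr ?exprn_gt0 ?mulr_gt0//.
  by rewrite exprMn rr mul1r (_ : 2 ^+ 2 = 4)//; ring.
pose v : R[i] := Complex s t.
have vT : v \in unit_circle R by rewrite unit_circle_sqnorm /sqnorm /= tt addrC subrK.
exists (u * v); first exact: unit_circleM.
have /unit_circleP uu := uT.
rewrite em !(rmorphM) /= -[LHS]/(_ + _).
have -> : (r%:C%C)^* = r%:C%C by rewrite conjE /= oppr0.
have -> : c%:C%C + r%:C%C * u * (u^* * v^*) + r%:C%C * u^* * (u * v)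
   = c%:C%C + r%:C%C * (u * u^*) * (v + v^*) by ring.
rewrite uu mulr1 addcJ_Re /= /s -!rmorphM -!rmorphD /=.
by rewrite [X in X%:C%C](_ : _ = 0)//; field; rewrite gt_eqF.
Qed.

(** The equation says that [cross] = - 2 Re(conj(m) y) with m the slope, and |Re z| <= |z|. Here y
    may be any point, since the bound serves for solutions inside the disc. *)
Lemma balanced_bound a b e x y : balanced a b e x y ->
  cross a b x ^+ 2 <= 4 * (sqnorm (slope a b e x) * sqnorm y).
Proof.
rewrite /balanced; move: (slope a b e x) => m bal.
have : (cross a b x)%:C%C = - ((m^* * y) + (m^* * y)^*).
  apply/eqP; rewrite -subr_eq0 -[X in _ == X]bal; apply/eqP.
  by rewrite [(m^* * y)^*]rmorphM /= conjCK; ring.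
rewrite addcJ_Re -rmorphN /= => /complexI ->.
rewrite sqrrN exprMn (_ : 2 ^+ 2 = 4); last by ring.
by rewrite ler_pM2l// -(sqnorm_conj m) -sqnormM lerDl sqr_ge0.
Qed.

Variables a1 b1 e1 a2 b2 e2 : R[i].

(** Eliminating conj(y) from the two balance equations leaves y * [cramer_det] = [cramer_num]. *)
Definition cramer_num x : R[i] :=
  (cross a1 b1 x)%:C%C * slope a2 b2 e2 x - (cross a2 b2 x)%:C%C * slope a1 b1 e1 x.
Definition cramer_det x : R[i] :=
  slope a1 b1 e1 x * (slope a2 b2 e2 x)^* - (slope a1 b1 e1 x)^* * slope a2 b2 e2 x.

Definition solvable := exists x y, [/\ x \in unit_circle R, y \in unit_circle R,
  balanced a1 b1 e1 x y & balanced a2 b2 e2 x y].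

Lemma conj_real (r : R) : (r%:C%C)^* = r%:C%C.
Proof. by rewrite conjE /= oppr0. Qed.

(** [cramer_det] is purely imaginary, so conjugating the hypothesis determines conj(y) too; both
    equations then hold after multiplication by the determinant. *)
Lemma cramer x y : cramer_det x != 0 -> y * cramer_det x = cramer_num x ->
  balanced a1 b1 e1 x y /\ balanced a2 b2 e2 x y.
Proof.
rewrite /cramer_det /cramer_num /balanced.
move: (slope a1 b1 e1 x) (slope a2 b2 e2 x) => m1 m2.
have := conj_real (cross a2 b2 x); have := conj_real (cross a1 b1 x).
move: (cross a1 b1 x)%:C%C (cross a2 b2 x)%:C%C => C1 C2 h1 h2 D0 yD.
have yD' : y^* * (m1 * m2^* - m1^* * m2) = C2 * m1^* - C1 * m2^*.
  have := congr1 Num.conj yD; rewrite !(rmorphM, rmorphB) /= !conjCK h1 h2.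
  by move=> h; apply: oppr_inj; rewrite opprB -h; ring.
split; apply: (mulIf D0); rewrite mul0r !mulrDl -!mulrA yD yD'; ring.
Qed.

(** The slopes are real-proportional and the constants share the ratio: slope 1 times equation 2
    equals slope 2 times equation 1. A point of the circle on the first line thus solves both. *)
Lemma parallel_lines x : cramer_det x = 0 -> cramer_num x = 0 ->
  slope a1 b1 e1 x != 0 ->
  cross a1 b1 x ^+ 2 <= 4 * sqnorm (slope a1 b1 e1 x) ->
  exists y, [/\ y \in unit_circle R, balanced a1 b1 e1 x y & balanced a2 b2 e2 x y].
Proof.
move=> /eqP; rewrite subr_eq0 => /eqP D0 /eqP; rewrite subr_eq0 => /eqP N0 m0 cm.
have [y yT bal] := real_line_meets_circle m0 cm.
exists y; split => //; apply: (mulfI m0); rewrite mulr0.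
rewrite -[RHS](mulr0 (slope a2 b2 e2 x)) -[X in _ = _ * X]bal.
move: D0 N0; move: (slope a1 b1 e1 x) (slope a2 b2 e2 x) => m1 m2 D0 N0.
transitivity ((cross a1 b1 x)%:C%C * m2 + m1 * m2 * y^* + m1^* * m2 * y).
  by rewrite N0 -D0; ring.
by ring.
Qed.

End TwoRows.

Lemma cramer_det_swap (R : realType) (a1 b1 e1 a2 b2 e2 x : R[i]) :
  cramer_det a2 b2 e2 a1 b1 e1 x = - cramer_det a1 b1 e1 a2 b2 e2 x.
Proof. by rewrite /cramer_det; ring. Qed.

Lemma cramer_num_swap (R : realType) (a1 b1 e1 a2 b2 e2 x : R[i]) :
  cramer_num a2 b2 e2 a1 b1 e1 x = - cramer_num a1 b1 e1 a2 b2 e2 x.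
Proof. by rewrite /cramer_num; ring. Qed.

(** Where a slope vanishes, its bound forces the constant to vanish, so that equation is void. One
    nonzero slope suffices for [parallel_lines]; with none, any y works. *)
Lemma degenerate_fibre (R : realType) (a1 b1 e1 a2 b2 e2 x : R[i]) :
  cramer_det a1 b1 e1 a2 b2 e2 x = 0 -> cramer_num a1 b1 e1 a2 b2 e2 x = 0 ->
  cross a1 b1 x ^+ 2 <= 4 * sqnorm (slope a1 b1 e1 x) ->
  cross a2 b2 x ^+ 2 <= 4 * sqnorm (slope a2 b2 e2 x) ->
  exists y, [/\ y \in unit_circle R, balanced a1 b1 e1 x y & balanced a2 b2 e2 x y].
Proof.
move=> D0 N0 g1 g2.
have [m1|m1] := eqVneq (slope a1 b1 e1 x) 0; last exact: parallel_lines.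
have [m2|m2] := eqVneq (slope a2 b2 e2 x) 0; last first.
  have [||//|y [yT ? ?]] := @parallel_lines _ a2 b2 e2 a1 b1 e1 x _ _ m2 => //.
  - by rewrite cramer_det_swap D0 oppr0.
  - by rewrite cramer_num_swap N0 oppr0.
  - by exists y.
exists 1; rewrite unit_circle1; split=> //; rewrite /balanced.
- move: g1; rewrite m1 sqnorm0 mulr0 rmorph0 !mul0r !addr0 => g1.
  by have /eqP -> : cross a1 b1 x == 0 by rewrite -sqrf_eq0 eq_le g1 sqr_ge0.
- move: g2; rewrite m2 sqnorm0 mulr0 rmorph0 !mul0r !addr0 => g2.
  by have /eqP -> : cross a2 b2 x == 0 by rewrite -sqrf_eq0 eq_le g2 sqr_ge0.
Qed.

(** * Continuity, arcs of the circle and the intermediate value argument *)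

Section RealContinuity.
Variables (R : realType) (f g : R -> R).
Hypotheses (cf : continuous f) (cg : continuous g).

Lemma continuous_addf : continuous (fun s => f s + g s).
Proof. by move=> s; apply: (@continuousD _ R^o _ f g); [exact: cf|exact: cg]. Qed.

Lemma continuous_subf : continuous (fun s => f s - g s).
Proof. by move=> s; apply: (@continuousB _ R^o _ f g); [exact: cf|exact: cg]. Qed.

Lemma continuous_mulf : continuous (fun s => f s * g s).
Proof. by move=> s; apply: (@continuousM _ _ f g); [exact: cf|exact: cg]. Qed.

Lemma continuous_minf : continuous (fun s => Num.min (f s) (g s)).
Proof. by move=> s; apply: (@continuous_min _ _ f g); [exact: cf|exact: cg]. Qed.

End RealContinuity.

Section ComplexContinuity.
Variable R : realType.
Implicit Types f g : R -> R[i].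

Definition ccontinuous f :=
  continuous (fun s => complex.Re (f s)) /\ continuous (fun s => complex.Im (f s)).

Lemma ccontinuous_cst (z : R[i]) : ccontinuous (fun=> z).
Proof. by split=> s; apply: cst_continuous. Qed.

Lemma ccontinuousD f g :
  ccontinuous f -> ccontinuous g -> ccontinuous (fun s => f s + g s).
Proof.
move=> [fr fi] [gr gi]; split.
- rewrite (_ : (fun s => _) = (fun s => complex.Re (f s) + complex.Re (g s))).
    exact: continuous_addf.
  by apply/funext => t; case: (f t) (g t) => [? ?] [? ?].
- rewrite (_ : (fun s => _) = (fun s => complex.Im (f s) + complex.Im (g s))).
    exact: continuous_addf.
  by apply/funext => t; case: (f t) (g t) => [? ?] [? ?].
Qed.

Lemma ccontinuousM f g :
  ccontinuous f -> ccontinuous g -> ccontinuous (fun s => f s * g s).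
Proof.
move=> [fr fi] [gr gi]; split.
- rewrite (_ : (fun s => _) = (fun s => complex.Re (f s) * complex.Re (g s)
    - complex.Im (f s) * complex.Im (g s))).
    by apply: continuous_subf; exact: continuous_mulf.
  by apply/funext => t; case: (f t) (g t) => [? ?] [? ?].
- rewrite (_ : (fun s => _) = (fun s => complex.Re (f s) * complex.Im (g s)
    + complex.Im (f s) * complex.Re (g s))).
    by apply: continuous_addf; exact: continuous_mulf.
  by apply/funext => t; case: (f t) (g t) => [? ?] [? ?].
Qed.

Lemma ccontinuous_conj f : ccontinuous f -> ccontinuous (fun s => (f s)^*).
Proof.
move=> [fr fi]; split.
- rewrite (_ : (fun s => _) = (fun s => complex.Re (f s))); first exact: fr.
  by apply/funext => t; rewrite conjE.
- rewrite (_ : (fun s => _) = (fun s => - complex.Im (f s))).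
    by move=> s; apply: (@continuousN _ R^o); exact: fi.
  by apply/funext => t; rewrite conjE.
Qed.

Lemma ccontinuous_real (f : R -> R) :
  continuous f -> ccontinuous (fun s => (f s)%:C%C).
Proof. by split=> //= s; apply: cst_continuous. Qed.

Lemma ccontinuousB f g :
  ccontinuous f -> ccontinuous g -> ccontinuous (fun s => f s - g s).
Proof.
move=> cf cg; have := ccontinuousD cf (ccontinuousM (ccontinuous_cst (-1)) cg).
by rewrite (_ : (fun s => f s + -1 * g s) = (fun s => f s - g s))//;
  apply/funext => s; rewrite mulN1r.
Qed.

Lemma continuous_sqnorm f :
  ccontinuous f -> continuous (fun s => sqnorm (f s)).
Proof.
by move=> [fr fi]; apply: continuous_addf; exact: continuous_mulf.
Qed.

Lemma continuous_cross (a b : R[i]) f :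
  ccontinuous f -> continuous (fun s => cross a b (f s)).
Proof.
move=> cf; apply: continuous_mulf; first by move=> s; exact: cst_continuous.
exact: (ccontinuousM (ccontinuous_cst (a^* * b)) cf).1.
Qed.

Lemma ccontinuous_slope (a b e : R[i]) f :
  ccontinuous f -> ccontinuous (fun s => slope a b e (f s)).
Proof.
move=> cf; apply: ccontinuousM; first exact: ccontinuous_cst.
apply: ccontinuousD; first exact: ccontinuous_cst.
by apply: ccontinuousM => //; exact: ccontinuous_cst.
Qed.

(** Up to the factor y, the arc is a graph over the real part t, running from t = Re(x conj(y)) to t
    = 1 on the side of the real axis where x conj(y) lies. *)
Lemma circle_path (x y : R[i]) : x \in unit_circle R -> y \in unit_circle R ->
  exists2 p : R -> R[i], ccontinuous p &
  exists2 s : R, [/\ s <= 1, p s = x & p 1 = y] &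
    {in `[s, 1], forall t, p t \in unit_circle R}.
Proof.
move=> xT yT; have /unit_circleP yy := yT.
pose z := x * y^*; pose s := complex.Re z; pose i := complex.Im z.
have zT : s ^+ 2 + i ^+ 2 = 1.
  by apply/eqP; rewrite -[_ == _]unit_circle_sqnorm unit_circleM// unit_circle_conj.
(* [Num.sqrt] is 0 on negative reals, so [p] is continuous on all of [R], though on the circle only
   for -1 <= t <= 1. *)
pose p (t : R) : R[i] := Complex t ((-1) ^+ (i < 0)%R * Num.sqrt (1 - t ^+ 2)) * y.
have i2 : 1 - s ^+ 2 = i ^+ 2 by rewrite -zT addrAC subrr add0r.
have ps : p s = x.
  rewrite /p i2 sqrtr_sqr -realEsign ?num_real// (_ : Complex s i = z).
    by rewrite /z -mulrA [y^* * y]mulrC yy mulr1.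
  by rewrite /s /i; case: (z).
have p1 : p 1 = y by rewrite /p expr1n subrr sqrtr0 mulr0 mul1r.
have s1 : s <= 1 by have := sqr_ge0 i; rewrite -i2; nra.
have s2 : -1 <= s by have := sqr_ge0 i; rewrite -i2; nra.
exists p.
  apply: ccontinuousM; last exact: ccontinuous_cst.
  split=> /=; first by move=> t; exact: cvg_id.
  apply: continuous_mulf; first by move=> t; exact: cst_continuous.
  move=> t; apply: (@continuous_comp _ _ _ (fun t : R => 1 - t ^+ 2) Num.sqrt).
    apply: continuous_subf => {}t; first exact: cst_continuous.
    exact: exprn_continuous.
  exact: sqrt_continuous.
exists s => // t; rewrite in_itv /= => /andP[st t1].
apply: unit_circleM => //; rewrite unit_circle_sqnorm /sqnorm /=.
rewrite exprMn sqrr_sign mul1r sqr_sqrtr; last by nra.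
by rewrite addrC subrK.
Qed.

End ComplexContinuity.

(** The intermediate value theorem is applied to [K], which is nonnegative at x0: either it is still
    nonnegative at the zero x1 of D, or it vanishes on the way. *)
Lemma solvable_along_path (R : realType) (a1 b1 e1 a2 b2 e2 x0 x1 : R[i]) :
  let N := cramer_num a1 b1 e1 a2 b2 e2 in
  let D := cramer_det a1 b1 e1 a2 b2 e2 in
  x0 \in unit_circle R -> x1 \in unit_circle R ->
  D x0 != 0 -> sqnorm (N x0) <= sqnorm (D x0) -> D x1 = 0 ->
  solvable a1 b1 e1 a2 b2 e2.
Proof.
move=> N D x0T x1T D0 ND D1.
(* [G1], [G2] >= 0 say that each line meets the closed disc; [H] >= 0 says |N / D| <= 1 where D is
   nonzero, and N = 0 where D = 0. Unlike the quotient, these stay continuous across zeros of D. *)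
pose G1 x := 4 * sqnorm (slope a1 b1 e1 x) - cross a1 b1 x ^+ 2.
pose G2 x := 4 * sqnorm (slope a2 b2 e2 x) - cross a2 b2 x ^+ 2.
pose H x := sqnorm (D x) - sqnorm (N x).
pose K x := Num.min (Num.min (G1 x) (G2 x)) (H x).
have degenerate x : x \in unit_circle R -> D x = 0 -> 0 <= K x ->
    solvable a1 b1 e1 a2 b2 e2.
  move=> xT Dx; rewrite !le_min => /andP[/andP[]].
  rewrite !subr_ge0 => g1 g2; rewrite Dx sqnorm0 => n0.
  have N0 : N x = 0 by apply/eqP; rewrite -sqnorm_eq0 eq_le n0 sqnorm_ge0.
  have [y [yT h1 h2]] := degenerate_fibre Dx N0 g1 g2.
  by exists x, y.
have quot x : D x != 0 -> sqnorm (N x / D x) * sqnorm (D x) = sqnorm (N x).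
  by move=> Dx; rewrite -sqnormM divfK.
have K0 : 0 <= K x0.
  have [h1 h2] := cramer D0 (divfK D0 _).
  have y1 : sqnorm (N x0 / D x0) <= 1.
    by rewrite -(@ler_pM2r _ (sqnorm (D x0))) ?quot ?mul1r// lt_def sqnorm_eq0 D0 sqnorm_ge0.
  rewrite !le_min !subr_ge0 ND andbT; apply/andP; split.
  - by apply: le_trans (balanced_bound h1) _; rewrite ler_pM2l// ler_piMr// sqnorm_ge0.
  - by apply: le_trans (balanced_bound h2) _; rewrite ler_pM2l// ler_piMr// sqnorm_ge0.
have [K1|K1] := leP 0 (K x1); first exact: (degenerate x1).
have [p pc [s [s1 ps p1] pT]] := circle_path x0T x1T.
have cK : continuous (fun t => K (p t)).
  have cm a b e := ccontinuous_slope a b e pc.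
  have cc a b : continuous (fun t => cross a b (p t)) by exact: continuous_cross.
  have ccC a b : ccontinuous (fun t => (cross a b (p t))%:C%C).
    by apply: ccontinuous_real; exact: cc.
  have cG a b e : continuous
      (fun t => 4 * sqnorm (slope a b e (p t)) - cross a b (p t) ^+ 2).
    apply: continuous_subf; last by apply: continuous_mulf; exact: cc.
    apply: continuous_mulf; last exact: continuous_sqnorm.
    by move=> t; exact: cst_continuous.
  have cD : ccontinuous (fun t => D (p t)).
    by apply: ccontinuousB; apply: ccontinuousM => //; exact: ccontinuous_conj.
  have cN : ccontinuous (fun t => N (p t)).
    by apply: ccontinuousB; apply: ccontinuousM.
  apply: continuous_minf; first by apply: continuous_minf; exact: cG.
  by apply: continuous_subf; exact: continuous_sqnorm.
have [||t ts Kt] := @IVT R (fun t => K (p t)) s 1 0 s1.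
- exact: continuous_subspaceT.
- by rewrite ps p1 ge_min le_max K0 (ltW K1) orbT.
have ptT := pT _ ts.
have [Dt|Dt] := eqVneq (D (p t)) 0; first by apply: (degenerate (p t)); rewrite ?Kt.
have [h1 h2] := cramer Dt (divfK Dt _).
have Dp : 0 < sqnorm (D (p t)) by rewrite lt_def sqnorm_eq0 Dt sqnorm_ge0.
exists (p t), (N (p t) / D (p t)); split=> //.
rewrite unit_circle_sqnorm; apply/eqP/(mulIf (lt0r_neq0 Dp)); rewrite quot// mul1r.
(* [K] = 0 means that [H] <= 0 or that one of the lines is tangent or farther away; either way |N|
   >= |D|, while [H] >= 0 gives the converse. *)
have : 0 <= K (p t) by rewrite Kt.
rewrite !le_min => /andP[/andP[]].
have : K (p t) <= 0 by rewrite Kt.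
rewrite !ge_min => Kle G1p G2p Hp.
apply/eqP; rewrite eq_le -subr_ge0 Hp /=.
(* a line tangent to the unit circle misses the open disc *)
have tangent a b e : balanced a b e (p t) (N (p t) / D (p t)) ->
    slope a b e (p t) != 0 ->
    4 * sqnorm (slope a b e (p t)) - cross a b (p t) ^+ 2 <= 0 ->
    sqnorm (D (p t)) <= sqnorm (N (p t)).
  move=> bal m0; rewrite subr_le0 => /le_trans/(_ (balanced_bound bal)).
  have mp : 0 < sqnorm (slope a b e (p t)) by rewrite lt_def sqnorm_eq0 m0 sqnorm_ge0.
  by rewrite ler_pM2l// ler_pMr// -(ler_pM2r Dp) mul1r quot.
case/orP: Kle => [/orP[]|]; last by rewrite subr_le0.
- apply: tangent h1 _; apply: contraNneq Dt => m0.
  by rewrite /D /cramer_det m0 rmorph0 !mul0r subrr.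
- apply: tangent h2 _; apply: contraNneq Dt => m0.
  by rewrite /D /cramer_det m0 rmorph0 !mulr0 subrr.
Qed.

(** * The primitive cube root of unity *)

Section Omega.
Variable R : realType.

Let theta : R := 2 * pi / 3.

Lemma omegaE : omega R = Complex (cos theta) (sin theta).
Proof.
rewrite /omega (_ : 2 * _ * _ / 3 = Complex 0 theta); last first.
  have -> : 3^-1 = (3^-1 : R)%:C%C :> R[i] by rewrite fmorphV rmorph_nat.
  have -> : 2 = (2 : R)%:C%C :> R[i] by rewrite rmorph_nat.
  by apply/eqP; rewrite eq_complex /=; apply/andP; split; apply/eqP; rewrite /theta; ring.
by rewrite /cexp expR0 !mul1r.
Qed.

Lemma omega_unit_circle : omega R \in unit_circle R.
Proof. by rewrite unit_circle_sqnorm omegaE /sqnorm /= cos2Dsin2. Qed.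

(** The triple-angle formula turns cos(3 theta) = 1 into (c - 1)(2 c + 1)^2 = 0 for c = cos theta,
    and 0 < theta < pi excludes c = 1. *)
Lemma cos_theta : cos theta = - 2^-1.
Proof.
have pi0 := pi_gt0 R.
have c3 : cos (theta + theta + theta) = 1.
  by rewrite -[RHS](cos2pi R); congr cos; rewrite /theta mulr2n; field.
have c1 : cos theta < 1.
  rewrite -[X in _ < X](@cos0 R) ltr_cos ?in_itv /= /theta; lra.
have s2 := cos2Dsin2 theta.
rewrite !cosD !sinD in c3.
have : (cos theta - 1) * (2 * cos theta + 1) ^+ 2 = 0.
  have -> : (cos theta - 1) * (2 * cos theta + 1) ^+ 2
    = 4 * cos theta ^+ 3 - 3 * cos theta - 1 by ring.
  rewrite -[X in _ - X]c3.
  rewrite (_ : _ - _ = 3 * cos theta * (cos theta ^+ 2 + sin theta ^+ 2 - 1)); last by ring.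
  by rewrite s2; ring.
move=> /eqP; rewrite mulf_eq0 sqrf_eq0 => /orP[] /eqP h; lra.
Qed.

Lemma omega_sum : 1 + omega R + (omega R)^* = 0.
Proof.
rewrite -addrA addcJ_Re omegaE /= cos_theta; apply/eqP.
by rewrite eq_complex /= addr0 eqxx andbT; apply/eqP; field.
Qed.

Lemma omega_sq : omega R ^+ 2 = (omega R)^*.
Proof.
have /unit_circleP h := omega_unit_circle; move: h.
have -> : (omega R)^* = - 1 - omega R by rewrite -[RHS]addr0 -omega_sum; ring.
move=> h; apply/eqP; rewrite -subr_eq0.
rewrite (_ : _ - _ = 1 - omega R * (- 1 - omega R)); last by ring.
by rewrite h subrr.
Qed.

End Omega.

(** * Laurent expansions of the Cramer determinant and numerator *)

Section Coupling.
Variable R : realType.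
Implicit Types a b e x y z A B C : R[i].

(** Parseval for the Fourier transform on Z/3: the mixed terms cancel by 1 + w + w^2 = 0. *)
Lemma parseval3 A B C (w := omega R) :
  sqnorm (A + B + C) + sqnorm (A * w^* + B * w + C) + sqnorm (A * w + B * w^* + C)
    = 3 * (sqnorm A + sqnorm B + sqnorm C).
Proof.
have lift (p q r s t u : R) : p%:C%C + q%:C%C + r%:C%C = 3 * (s%:C%C + t%:C%C + u%:C%C) ->
    p + q + r = 3 * (s + t + u).
  by move=> h; apply: (@complexI R); rewrite rmorphM rmorph_nat !rmorphD.
apply: lift; rewrite !sqnormC.
have /unit_circleP h := omega_unit_circle R; have s := omega_sum R.
rewrite -/w in h s *; have h2 : w^* = - 1 - w by rewrite -[RHS]addr0 -s; ring.
rewrite !(rmorphD, rmorphM) /= !conjCK; move: h; rewrite h2 => h.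
have ww : w * w = - 1 - w by rewrite -h2 -omega_sq expr2.
by ring: ww.
Qed.

(** Up to sign, the coefficient of x in [cramer_det] when the rows are orthogonal. Its cyclic column
    shifts give the x and constant coefficients of [cramer_num]. *)
Definition coupling a1 b1 e1 a2 b2 e2 :=
  e1 * e2^* * a1^* * b2 - e1^* * e2 * b1 * a2^*.

Variables a1 b1 e1 a2 b2 e2 : R[i].
Hypothesis orth : a1 * a2^* + b1 * b2^* + e1 * e2^* = 0.

Let orthE : e1 * e2^* = - (a1 * a2^*) - b1 * b2^*.
Proof. by rewrite -[RHS]addr0 -orth; ring. Qed.

Let orthJ : e1^* * e2 = - (a1^* * a2) - b1^* * b2.
Proof.
have := congr1 Num.conj orthE.
by rewrite !(rmorphB, rmorphN, rmorphM) /= !conjCK.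
Qed.

(** By orthogonality the constant term of slope 1 times conj(slope 2) is - |e1 e2|^2; being real, it
    cancels against its conjugate. *)
Lemma cramer_detE x : x \in unit_circle R ->
  cramer_det a1 b1 e1 a2 b2 e2 x
  = (coupling a1 b1 e1 a2 b2 e2 * x)^* - coupling a1 b1 e1 a2 b2 e2 * x.
Proof.
move=> /unit_circleP xx; rewrite /cramer_det /coupling /slope.
rewrite !(rmorphB, rmorphD, rmorphM) /= !conjCK.
transitivity ((e1^* * e2) * (a1 * a2^* + b1 * b2^* * (x * x^*) + a1 * b2^* * x^* + b1 * a2^* * x)
  - (e1 * e2^*) * (a1^* * a2 + b1^* * b2 * (x * x^*) + a1^* * b2 * x + b1^* * a2 * x^*)).
  by ring.
rewrite xx !mulr1 orthJ orthE; ring.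
Qed.

Definition coef_sq := a1^* * b1 * (e2^* * b2) - a2^* * b2 * (e1^* * b1).
Definition coef_inv := a1 * b1^* * (e2^* * a2) - a2 * b2^* * (e1^* * a1).

(** The terms in x^2 and conj(x) are grouped because both are multiplied by conj(w) when x becomes x
    w. *)
Lemma cramer_numE x : x \in unit_circle R ->
  cramer_num a1 b1 e1 a2 b2 e2 x
  = (coef_sq * x ^+ 2 + coef_inv * x^*)
    + (coupling b1 e1 a1 b2 e2 a2)^* * x - coupling e1 a1 b1 e2 a2 b2.
Proof.
move=> /unit_circleP xx; rewrite /cramer_num !crossC /slope /coef_sq /coef_inv /coupling.
rewrite !(rmorphB, rmorphD, rmorphM) /= !conjCK.
by ring: xx.
Qed.

(* Both sides equal 4 (Im (a1 a2^* b1^* b2))^2, an invariant of the column order. *)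
Lemma coef_coupling :
  sqnorm coef_inv - sqnorm (coupling b1 e1 a1 b2 e2 a2)
  = sqnorm coef_sq - sqnorm (coupling e1 a1 b1 e2 a2 b2).
Proof.
apply: (@complexI R); rewrite !rmorphB /= !sqnormC /coef_sq /coef_inv /coupling.
rewrite !(rmorphB, rmorphD, rmorphM) /= !conjCK.
pose X := a1 * a2^*; pose Y := b1 * b2^*; pose Z := e1 * e2^*.
pose X' := a1^* * a2; pose Y' := b1^* * b2; pose Z' := e1^* * e2.
transitivity ((Y' * X - Y * X') * (Z' * X - Z * X')).
  by rewrite /X /Y /Z /X' /Y' /Z'; ring.
transitivity ((X' * Y - X * Y') * (Z' * Y - Z * Y')); last first.
  by rewrite /X /Y /Z /X' /Y' /Z'; ring.
by rewrite /Z /Z' orthE orthJ -/X -/Y -/X' -/Y'; ring.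
Qed.

End Coupling.

(** * Existence of x, y making two orthonormal rows unimodular *)

Section Existence.
Variable R : realType.
Implicit Types a b e x y z A B C E : R[i].
Local Notation T := (unit_circle R).
Local Notation w := (omega R).

(** Rotation by w acts on 1, x and the pair x^2, conj(x) by three different characters of Z/3, so
    [parseval3] separates these parts but keeps the pair together. *)
Lemma parseval_points (f : R[i] -> R[i]) A B C E x :
  (forall z, z \in T -> f z = A * z ^+ 2 + B * z + C * z^* + E) -> x \in T ->
  sqnorm (f x) + sqnorm (f (x * w)) + sqnorm (f (x * w^*))
    = 3 * (sqnorm (A * x ^+ 2 + C * x^*) + sqnorm B + sqnorm E).
Proof.
move=> fE xT; have wT := omega_unit_circle R.
have w2 := omega_sq R; have w2' : w^* ^+ 2 = w.
  by rewrite -rmorphXn /= w2 conjCK.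
have -> : sqnorm B = sqnorm (B * x).
  by move: xT; rewrite unit_circle_sqnorm sqnormM => /eqP->; rewrite mulr1.
have xwT : x * w \in T by rewrite unit_circleM.
have xwT' : x * w^* \in T by rewrite unit_circleM// unit_circle_conj.
rewrite -parseval3 (fE _ xT) (fE _ xwT) (fE _ xwT') !exprMn w2 w2' !rmorphM /= conjCK.
by congr (sqnorm _ + sqnorm _ + sqnorm _); ring.
Qed.

(** If every index failed, each n would be at least its d, strictly where d > 0, against the
    comparison of the sums. *)
Lemma three_term_choice (d1 d2 d3 n1 n2 n3 : R) :
  0 <= n1 -> 0 <= n2 -> 0 <= n3 -> 0 <= d1 -> 0 <= d2 -> 0 <= d3 ->
  n1 + n2 + n3 <= d1 + d2 + d3 -> 0 < d1 + d2 + d3 ->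
  [\/ (0 < d1) && (n1 <= d1), (0 < d2) && (n2 <= d2) | (0 < d3) && (n3 <= d3)].
Proof.
move=> *; have [h1|h1] := boolP ((0 < d1) && (n1 <= d1)); first by constructor 1.
have [h2|h2] := boolP ((0 < d2) && (n2 <= d2)); first by constructor 2.
constructor 3; move: h1 h2; rewrite !negb_and -!leNgt -!ltNge.
by case/orP=> ? /orP[]?; apply/andP; split; lra.
Qed.

Section Rows.
Variables a1 b1 e1 a2 b2 e2 : R[i].
Hypothesis orth : a1 * a2^* + b1 * b2^* + e1 * e2^* = 0.
Let N := cramer_num a1 b1 e1 a2 b2 e2.
Let D := cramer_det a1 b1 e1 a2 b2 e2.
(** Each coupling is named after the column that takes the role of [e]. *)
Let da := coupling b1 e1 a1 b2 e2 a2.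
Let db := coupling e1 a1 b1 e2 a2 b2.
Let dc := coupling a1 b1 e1 a2 b2 e2.

(** The x from [pair_alignment] makes this sum as small as possible. *)
Lemma sum_cramer_num : exists2 x, x \in T &
  sqnorm (N x) + sqnorm (N (x * w)) + sqnorm (N (x * w^*)) = 3 * (
    (Num.sqrt (sqnorm (coef_sq a1 b1 e1 a2 b2 e2))
      - Num.sqrt (sqnorm (coef_inv a1 b1 e1 a2 b2 e2))) ^+ 2 + sqnorm da + sqnorm db).
Proof.
have [x xT <-] := pair_alignment (coef_sq a1 b1 e1 a2 b2 e2) (coef_inv a1 b1 e1 a2 b2 e2).
exists x => //; rewrite (@parseval_points _ (coef_sq a1 b1 e1 a2 b2 e2) da^*
  (coef_inv a1 b1 e1 a2 b2 e2) (- db))//; first by rewrite sqnormN sqnorm_conj.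
by move=> z zT; rewrite /N cramer_numE// -/da -/db; ring.
Qed.

Lemma sum_cramer_det x : x \in T ->
  sqnorm (D x) + sqnorm (D (x * w)) + sqnorm (D (x * w^*)) = 6 * sqnorm dc.
Proof.
move=> xT; rewrite (@parseval_points _ 0 (- dc) dc^* 0)//.
  rewrite sqnorm0 sqnormN mul0r add0r sqnormM !sqnorm_conj.
  by move: xT; rewrite unit_circle_sqnorm => /eqP->; ring.
by move=> z zT; rewrite /D cramer_detE// -/dc rmorphM /=; ring.
Qed.

(** Comparing the sums of |N|^2 and |D|^2 over three points yields a start for
    [solvable_along_path]; the end is an explicit zero of D. *)
Lemma solvable_coupling : dc != 0 -> sqnorm da <= sqnorm dc -> sqnorm db <= sqnorm dc ->
  solvable a1 b1 e1 a2 b2 e2.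
Proof.
move=> d0 dac dbc; have [x xT sN] := sum_cramer_num.
have sD := sum_cramer_det xT; have wT := omega_unit_circle R.
have dcp : 0 < sqnorm dc by rewrite lt_def sqnorm_eq0 d0 sqnorm_ge0.
(* With u the phase of [dc], the product [dc] conj(u) is real, so D vanishes at conj(u). *)
have [u uT ud] := polar dc.
have Du : D u^* = 0.
  rewrite /D cramer_detE ?unit_circle_conj// -/dc ud -mulrA.
  by have /unit_circleP -> := uT; rewrite mulr1 conj_real subrr.
have finish z : z \in T -> (0 < sqnorm (D z)) && (sqnorm (N z) <= sqnorm (D z)) ->
    solvable a1 b1 e1 a2 b2 e2.
  move=> zT /andP[D0 ND]; apply: (@solvable_along_path _ _ _ _ _ _ _ z u^*) => //.
    by rewrite unit_circle_conj.
  by rewrite -sqnorm_eq0 gt_eqF.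
have := @three_term_choice (sqnorm (D x)) (sqnorm (D (x * w))) (sqnorm (D (x * w^*)))
  (sqnorm (N x)) (sqnorm (N (x * w))) (sqnorm (N (x * w^*))).
rewrite sN sD; case; rewrite ?sqnorm_ge0//.
(* The claim is (p - q)^2 + |da|^2 + |db|^2 <= 2 |dc|^2. If p <= q, then (p - q)^2 <= q^2 - p^2 =
   |da|^2 - |db|^2, so the left side is at most 2 |da|^2; otherwise it is at most 2 |db|^2. *)
- have := coef_coupling orth; rewrite -/da -/db.
  set p := Num.sqrt _; set q := Num.sqrt _.
  have p0 : 0 <= p by rewrite sqrtr_ge0.
  have q0 : 0 <= q by rewrite sqrtr_ge0.
  have -> : sqnorm (coef_inv a1 b1 e1 a2 b2 e2) = q ^+ 2 by rewrite sqr_sqrtr ?sqnorm_ge0.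
  have -> : sqnorm (coef_sq a1 b1 e1 a2 b2 e2) = p ^+ 2 by rewrite sqr_sqrtr ?sqnorm_ge0.
  by have [pq|pq] := leP p q; nra.
- lra.
- exact: finish.
- by apply: finish; rewrite unit_circleM.
- by apply: finish; rewrite unit_circleM// unit_circle_conj.
Qed.

(** Now D vanishes on the whole circle, so x need only satisfy N = 0 and put the common line within
    distance 1 of the origin. *)
Lemma solvable_uncoupled : a1 * a1^* + b1 * b1^* + e1 * e1^* = 1 ->
  da = 0 -> db = 0 -> dc = 0 -> sqnorm a1 <= sqnorm e1 -> sqnorm b1 <= sqnorm e1 ->
  solvable a1 b1 e1 a2 b2 e2.
Proof.
move=> n1 da0 db0 dc0 ae be; have wT := omega_unit_circle R.
have s1 : sqnorm a1 + sqnorm b1 + sqnorm e1 = 1.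
  by apply: (@complexI R); rewrite 2!rmorphD /= !sqnormC.
have a0 := sqnorm_ge0 a1; have b0 := sqnorm_ge0 b1; have e0 := sqnorm_ge0 e1.
(* If a1 = b1 = 0 the strict inequality used below is impossible. But then orthogonality forces e2 =
   0, and only [cross a2 b2 x] = 0 remains to be solved: x = i conj(u) makes conj(a2) b2 x purely
   imaginary. *)
have [/eqP ab0|ab0] := boolP (sqnorm a1 + sqnorm b1 == 0).
  have a10 : a1 = 0 by apply/eqP; rewrite -sqnorm_eq0; apply/eqP; lra.
  have b10 : b1 = 0 by apply/eqP; rewrite -sqnorm_eq0; apply/eqP; lra.
  have e20 : e2 = 0.
    have /eqP := orth; rewrite a10 b10 !mul0r !add0r mulf_eq0 -sqnorm_eq0 conjC_eq0.
    case/orP => [/eqP h|/eqP//]; suff : 0 < sqnorm e1 by rewrite h ltxx.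
    by lra.
  have [u uT ud] := polar (a2^* * b2).
  exists ('i%C * u^*), 1; split; rewrite ?unit_circle1//.
  - rewrite unit_circleM ?unit_circle_conj// unit_circle_sqnorm /sqnorm /=.
    by rewrite expr0n expr1n add0r.
  - by rewrite /balanced /slope /cross a10 b10 rmorph0 !(mul0r, mulr0, addr0, rmorph0).
  - rewrite /balanced /slope e20 !(rmorph0, mul0r, addr0) /cross ud.
    rewrite mulrCA -mulrA; have /unit_circleP -> := uT.
    by rewrite mulr1 /= mul0r !mul1r subrr mulr0.
have [x xT sN] := sum_cramer_num.
(* With no couplings |coef_sq| = |coef_inv|, so the aligned sum of |N|^2 is 0 and N vanishes at all
   three points. *)
have := coef_coupling orth; rewrite -/da -/db da0 db0 sqnorm0 !subr0 => pq.
rewrite pq subrr da0 db0 sqnorm0 expr0n !addr0 mulr0 in sN.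
have [N1 N2 N3] : [/\ N x = 0, N (x * w) = 0 & N (x * w^*) = 0].
  have := sqnorm_ge0 (N x); have := sqnorm_ge0 (N (x * w)).
  by have := sqnorm_ge0 (N (x * w^*)) => *; split; apply/eqP; rewrite -sqnorm_eq0;
    apply/eqP; lra.
have sS : sqnorm (a1 + b1 * x) + sqnorm (a1 + b1 * (x * w))
    + sqnorm (a1 + b1 * (x * w^*)) = 3 * (sqnorm b1 + sqnorm a1).
  rewrite (@parseval_points (fun z => a1 + b1 * z) 0 b1 0 a1)//.
    by rewrite !mul0r addr0 sqnorm0 add0r.
  by move=> z _; ring.
have sC : cross a1 b1 x ^+ 2 + cross a1 b1 (x * w) ^+ 2 + cross a1 b1 (x * w^*) ^+ 2
    = 6 * (sqnorm a1 * sqnorm b1).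
  rewrite -!sqnorm_real (@parseval_points (fun z => (cross a1 b1 z)%:C%C) 0
    (a1^* * b1) (a1 * b1^*) 0)//; last by move=> z _; rewrite crossC; ring.
  rewrite mul0r add0r sqnorm0 !sqnormM !sqnorm_conj.
  by move: xT; rewrite unit_circle_sqnorm => /eqP->; ring.
have finish z : z \in T -> N z = 0 ->
    cross a1 b1 z ^+ 2 < 4 * (sqnorm e1 * sqnorm (a1 + b1 * z)) ->
    solvable a1 b1 e1 a2 b2 e2.
  move=> zT Nz lt; have sE : sqnorm (slope a1 b1 e1 z) = sqnorm e1 * sqnorm (a1 + b1 * z).
    by rewrite sqnormM sqnorm_conj.
  have Dz : D z = 0 by rewrite /D cramer_detE// -/dc dc0 mul0r rmorph0 subrr.
  have [||y [yT h1 h2]] := parallel_lines Dz Nz; last by exists z, y.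
  - apply: contraTneq lt; rewrite -sE => ->.
    by rewrite sqnorm0 mulr0 -leNgt sqr_ge0.
  - by rewrite sE ltW.
have [h1|h1] := ltP (cross a1 b1 x ^+ 2) (4 * (sqnorm e1 * sqnorm (a1 + b1 * x))).
  exact: (finish x).
have [h2|h2] := ltP (cross a1 b1 (x * w) ^+ 2)
    (4 * (sqnorm e1 * sqnorm (a1 + b1 * (x * w)))).
  by apply: finish h2 => //; rewrite unit_circleM.
apply: (finish (x * w^*)) => //; first by rewrite unit_circleM// unit_circle_conj.
rewrite ltNge; apply/negP => h3.
have e1p : 0 < sqnorm e1 by lra.
have abp : 0 < sqnorm a1 + sqnorm b1 by rewrite lt_def ab0 addr_ge0.
(* The three failed inequalities add up to 12 |e1|^2 (|a1|^2 + |b1|^2) <= 6 |a1|^2 |b1|^2,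
   contradicting |a1| <= |e1| as the left side is positive. *)
have : 4 * (sqnorm e1 * (3 * (sqnorm b1 + sqnorm a1))) <= 6 * (sqnorm a1 * sqnorm b1).
  by rewrite -sS -sC; lra.
have := mulr_gt0 e1p abp.
have : sqnorm a1 * sqnorm b1 <= sqnorm e1 * sqnorm b1 by rewrite ler_wpM2r.
have := mulr_ge0 (ltW e1p) a0; lra.
Qed.

End Rows.

Lemma solvable_unimodular a1 b1 e1 a2 b2 e2 :
  a1 * a1^* + b1 * b1^* + e1 * e1^* = 1 -> a2 * a2^* + b2 * b2^* + e2 * e2^* = 1 ->
  solvable a1 b1 e1 a2 b2 e2 -> exists x y, [/\ x \in T, y \in T,
    a1 + b1 * x + e1 * y \in T & a2 + b2 * x + e2 * y \in T].
Proof.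
move=> n1 n2 [x [y [xT yT h1 h2]]]; exists x, y; split=> //; exact: balanced_norm.
Qed.

(** Multiplying the vector by conj(y) normalises the coordinate of column a to 1, so the columns may
    be shifted cyclically. *)
Lemma unimodular_rotate a1 b1 e1 a2 b2 e2 :
  (exists x y, [/\ x \in T, y \in T,
    b1 + e1 * x + a1 * y \in T & b2 + e2 * x + a2 * y \in T]) ->
  exists x y, [/\ x \in T, y \in T,
    a1 + b1 * x + e1 * y \in T & a2 + b2 * x + e2 * y \in T].
Proof.
move=> [x [y [xT yT h1 h2]]]; have y'T : y^* \in T by rewrite unit_circle_conj.
have /unit_circleP yy := yT; exists y^*, (x * y^*).
have mul_conj a b e : a + b * y^* + e * (x * y^*) = (b + e * x + a * y) * y^*.
  by rewrite -[X in X + _ + _]mulr1 -yy; ring.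
by split; rewrite ?mul_conj ?unit_circleM.
Qed.

(** The column moved to the last place is the one of largest coupling or, when all couplings vanish,
    the one of largest entry in the first row. *)
Lemma unimodular_image a1 b1 e1 a2 b2 e2 :
  a1 * a1^* + b1 * b1^* + e1 * e1^* = 1 -> a2 * a2^* + b2 * b2^* + e2 * e2^* = 1 ->
  a1 * a2^* + b1 * b2^* + e1 * e2^* = 0 -> exists x y, [/\ x \in T, y \in T,
    a1 + b1 * x + e1 * y \in T & a2 + b2 * x + e2 * y \in T].
Proof.
move=> n1 n2 o; have o' : b1 * b2^* + e1 * e2^* + a1 * a2^* = 0 by rewrite -o; ring.
have o'' : e1 * e2^* + a1 * a2^* + b1 * b2^* = 0 by rewrite -o; ring.
have n1' : b1 * b1^* + e1 * e1^* + a1 * a1^* = 1 by rewrite -n1; ring.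
have n2' : b2 * b2^* + e2 * e2^* + a2 * a2^* = 1 by rewrite -n2; ring.
have n1'' : e1 * e1^* + a1 * a1^* + b1 * b1^* = 1 by rewrite -n1; ring.
have n2'' : e2 * e2^* + a2 * a2^* + b2 * b2^* = 1 by rewrite -n2; ring.
pose da := coupling b1 e1 a1 b2 e2 a2; pose db := coupling e1 a1 b1 e2 a2 b2.
pose dc := coupling a1 b1 e1 a2 b2 e2.
have [dc0|dc0] := eqVneq (Num.max (Num.max (sqnorm da) (sqnorm db)) (sqnorm dc)) 0.
  have := lexx (Num.max (Num.max (sqnorm da) (sqnorm db)) (sqnorm dc)).
  rewrite {2}dc0 !ge_max => /andP[/andP[]].
  have null z : sqnorm z <= 0 -> z = 0.
    by move=> z0; apply/eqP; rewrite -sqnorm_eq0 eq_le z0 sqnorm_ge0.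
  move=> /null da0 /null db0 /null {}dc0.
  have [ab|/ltW ba] := leP (sqnorm a1) (sqnorm b1).
  - have [be|/ltW eb] := leP (sqnorm b1) (sqnorm e1).
    + by apply/solvable_unimodular/solvable_uncoupled => //; exact: le_trans be.
    + by apply/unimodular_rotate/unimodular_rotate/solvable_unimodular => //;
        apply: solvable_uncoupled.
  - have [ae|/ltW ea] := leP (sqnorm a1) (sqnorm e1).
    + by apply/solvable_unimodular/solvable_uncoupled => //; exact: le_trans ae.
    + by apply/unimodular_rotate/solvable_unimodular/solvable_uncoupled.
have max_neq0 z : sqnorm z != 0 -> z != 0 by rewrite sqnorm_eq0.
move: dc0; have [ab|/ltW ba] := leP (sqnorm da) (sqnorm db).
- have [bc|/ltW cb] := leP (sqnorm db) (sqnorm dc) => /max_neq0 n0.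
  + apply/solvable_unimodular/solvable_coupling => //; exact: le_trans bc.
  + by apply/unimodular_rotate/unimodular_rotate/solvable_unimodular => //;
      apply: solvable_coupling.
- have [ac|/ltW ca] := leP (sqnorm da) (sqnorm dc) => /max_neq0 n0.
  + apply/solvable_unimodular/solvable_coupling => //; exact: le_trans ac.
  + by apply/unimodular_rotate/solvable_unimodular/solvable_coupling.
Qed.

End Existence.

(** * Unitary 3 x 3 matrices up to a scalar, and the 2 x 2 block *)

Section ThreeByThree.
Local Open Scope sesquilinear_scope.
Variable R : realType.
Local Notation T := (unit_circle R).

Lemma sum_ord3 (V : zmodType) (F : 'I_3 -> V) : \sum_i F i = F 0 + F 1 + F 2.
Proof.
rewrite !big_ord_recl big_ord0 addr0 addrA.
by congr (_ + F _ + F _); apply: val_inj.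
Qed.

Lemma ord3_ind (P : 'I_3 -> Prop) : P 0 -> P 1 -> P 2 -> forall i, P i.
Proof.
move=> P0 P1 P2 [[|[|[|//]]] i3].
- by rewrite (_ : Ordinal i3 = 0)//; apply: val_inj.
- by rewrite (_ : Ordinal i3 = 1)//; apply: val_inj.
- by rewrite (_ : Ordinal i3 = 2)//; apply: val_inj.
Qed.

Lemma matrix3P (X Y : 'M[R[i]]_3) :
  [/\ X 0 0 = Y 0 0, X 0 1 = Y 0 1 & X 0 2 = Y 0 2] ->
  [/\ X 1 0 = Y 1 0, X 1 1 = Y 1 1 & X 1 2 = Y 1 2] ->
  [/\ X 2 0 = Y 2 0, X 2 1 = Y 2 1 & X 2 2 = Y 2 2] -> X = Y.
Proof.
move=> [? ? ?] [? ? ?] [? ? ?]; apply/matrixP.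
by elim/ord3_ind; elim/ord3_ind.
Qed.

(** The scale k lets the unnormalised factors be multiplied without square roots: 3 for the Fourier
    matrices, 4 for the middle one. *)
Definition scaled_unitary (k : R[i]) (X : 'M[R[i]]_3) := X *m X^t* = k%:M.

Lemma scaled_unitaryM k l X Y :
  scaled_unitary k X -> scaled_unitary l Y -> scaled_unitary (k * l) (X *m Y).
Proof.
rewrite /scaled_unitary => hX hY.
rewrite trmx_mul map_mxM mulmxA -(mulmxA X) hY mul_mx_scalar -scalemxAl hX.
by rewrite scale_scalar_mx mulrC.
Qed.

Lemma scaled_unitaryZ k c X :
  scaled_unitary k X -> scaled_unitary (c * c^* * k) (c *: X).
Proof.
rewrite /scaled_unitary => hX.
by rewrite linearZ /= map_mxZ -scalemxAl -scalemxAr hX !scale_scalar_mx mulrA.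
Qed.

Lemma scaled_unitary_rowP k X : scaled_unitary k X <->
  [/\ X 0 0 * (X 0 0)^* + X 0 1 * (X 0 1)^* + X 0 2 * (X 0 2)^* = k,
      X 1 0 * (X 1 0)^* + X 1 1 * (X 1 1)^* + X 1 2 * (X 1 2)^* = k &
      X 2 0 * (X 2 0)^* + X 2 1 * (X 2 1)^* + X 2 2 * (X 2 2)^* = k] /\
  [/\ X 0 0 * (X 1 0)^* + X 0 1 * (X 1 1)^* + X 0 2 * (X 1 2)^* = 0,
      X 0 0 * (X 2 0)^* + X 0 1 * (X 2 1)^* + X 0 2 * (X 2 2)^* = 0 &
      X 1 0 * (X 2 0)^* + X 1 1 * (X 2 1)^* + X 1 2 * (X 2 2)^* = 0].
Proof.
have entry i j : (X *m X^t*) i j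
    = X i 0 * (X j 0)^* + X i 1 * (X j 1)^* + X i 2 * (X j 2)^*.
  by rewrite mxE sum_ord3 !mxE.
split=> [h|[[h1 h2 h3] [h4 h5 h6]]].
  by split; split; rewrite -entry h mxE.
have J i j : X i 0 * (X j 0)^* + X i 1 * (X j 1)^* + X i 2 * (X j 2)^* = 0 ->
    X j 0 * (X i 0)^* + X j 1 * (X i 1)^* + X j 2 * (X i 2)^* = 0.
  move=> h; have := congr1 Num.conj h; rewrite !(rmorphD, rmorphM, rmorph0) /= !conjCK.
  by move=> <-; ring.
by apply: matrix3P; rewrite !entry ![(k%:M) _ _]mxE /=; split=> //; apply: J.
Qed.

(** A one-sided inverse of a square matrix is two-sided, and k is real as the squared norm of a
    row. *)
Lemma scaled_unitary_adjoint k X : k != 0 ->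
  scaled_unitary k X -> scaled_unitary k^* (X^t*).
Proof.
rewrite /scaled_unitary => k0 hX.
have -> : (X^t*)^t* = X by apply/matrixP => i j; rewrite !mxE conjCK.
have h : X *m (k^-1 *: X^t*) = 1%:M by rewrite -scalemxAr hX scale_scalar_mx mulVf.
have kJ : k^* = k.
  have [[<- _ _] _] := (scaled_unitary_rowP k X).1 hX.
  by rewrite !(rmorphD, rmorphM) /= !conjCK; ring.
have := mulmx1C h; rewrite -scalemxAl => /(congr1 (fun Z => k *: Z)).
by rewrite scalerA divff// scale1r scalemx1 kJ.
Qed.

Definition diag3 (u v t : R[i]) : 'M[R[i]]_3 :=
  mx3 [:: [:: u; 0; 0]; [:: 0; v; 0]; [:: 0; 0; t]].

Lemma diag3_unitary u v t : u \in T -> v \in T -> t \in T ->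
  scaled_unitary 1 (diag3 u v t).
Proof.
move=> /unit_circleP uu /unit_circleP vv /unit_circleP tt.
apply/scaled_unitary_rowP; rewrite !mxE /= !rmorph0 !(mul0r, mulr0, addr0, add0r).
by split; split.
Qed.

Lemma diag3M u v t u' v' t' :
  diag3 u v t *m diag3 u' v' t' = diag3 (u * u') (v * v') (t * t').
Proof.
by apply: matrix3P; rewrite !mxE !sum_ord3 !mxE /= !(mul0r, mulr0, addr0, add0r).
Qed.

Lemma diag3_1 : diag3 1 1 1 = 1%:M.
Proof. by apply: matrix3P; rewrite !mxE. Qed.

Definition fourier3 : 'M[R[i]]_3 :=
  mx3 [:: [:: 1; 1; 1]; [:: 1; omega R; (omega R)^*]; [:: 1; (omega R)^*; omega R]].
Definition fourier3J : 'M[R[i]]_3 :=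
  mx3 [:: [:: 1; 1; 1]; [:: 1; (omega R)^*; omega R]; [:: 1; omega R; (omega R)^*]].

Lemma fourier3_adjoint : fourier3^t* = fourier3J.
Proof. by apply: matrix3P; rewrite !mxE /= ?rmorph1 ?conjCK. Qed.

Lemma fourier3_unitary : scaled_unitary 3 fourier3.
Proof.
have /unit_circleP h := omega_unit_circle R; have s := omega_sum R.
have h' : (omega R)^* * omega R = 1 by rewrite mulrC.
have w2 := omega_sq R; rewrite expr2 in w2.
have w2' : (omega R)^* * (omega R)^* = omega R by rewrite -rmorphM /= w2 conjCK.
have s' : 1 + (omega R)^* + omega R = 0 by rewrite -s; ring.
apply/scaled_unitary_rowP; rewrite !mxE /= !rmorph1 !conjCK !mul1r h h' w2 w2'.
by split; split=> //; rewrite ?s ?s' //; ring.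
Qed.

Lemma fourier3J_unitary : scaled_unitary 3 fourier3J.
Proof.
rewrite -fourier3_adjoint -[3](conjC_nat _ 3).
by apply: scaled_unitary_adjoint fourier3_unitary; rewrite pnatr_eq0.
Qed.

Lemma fourier3JK : fourier3J *m fourier3 = 3%:M.
Proof.
have := fourier3J_unitary; rewrite /scaled_unitary -fourier3_adjoint.
by rewrite (_ : (fourier3^t*)^t* = fourier3)//; apply/matrixP => i j; rewrite !mxE conjCK.
Qed.

Definition core3 (a b c z : R[i]) : 'M[R[i]]_3 :=
  mx3 [:: [:: 2; 0; 0]; [:: 0; a * (1 + z); a * c * (1 - z)];
          [:: 0; b * (1 - z); b * c * (1 + z)]].

(** For |z| = 1, |1 + z|^2 + |1 - z|^2 = 4, and (1 + z) conj(1 - z) is purely imaginary. *)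
Lemma core3_unitary a b c z : a \in T -> b \in T -> c \in T -> z \in T ->
  scaled_unitary 4 (core3 a b c z).
Proof.
move=> /unit_circleP aa /unit_circleP bb /unit_circleP cc /unit_circleP zz.
apply/scaled_unitary_rowP; rewrite !mxE /= !rmorph0 !(mul0r, mulr0, addr0, add0r).
rewrite !(rmorphM, rmorphB, rmorphD, rmorph1) /=.
split; split=> //.
- by ring.
- transitivity (a * a^* * ((1 + z) * (1 + z^*) + c * c^* * ((1 - z) * (1 - z^*)))).
    by ring.
  by rewrite aa cc; ring: zz.
- transitivity (b * b^* * ((1 - z) * (1 - z^*) + c * c^* * ((1 + z) * (1 + z^*)))).
    by ring.
  by rewrite bb cc; ring: zz.
- transitivity (a * b^* * ((1 + z) * (1 - z^*) + c * c^* * ((1 - z) * (1 + z^*)))).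
    by ring.
  by rewrite cc; ring: zz.
Qed.

Lemma same_sqnorm (u v : R[i]) : sqnorm u = sqnorm v -> exists2 a, a \in T & u = a * v.
Proof.
move=> uv; have [v0|v0] := eqVneq v 0.
  exists 1; first exact: unit_circle1.
  by rewrite v0 mulr0; apply/eqP; rewrite -sqnorm_eq0 uv v0 sqnorm0.
have v0' : sqnorm v != 0 by rewrite sqnorm_eq0.
exists (u / v); last by rewrite divfK.
by rewrite unit_circle_sqnorm; apply/eqP/(mulIf v0'); rewrite -sqnormM divfK// mul1r.
Qed.

(** The modulus of p fixes Re z; all four moduli then agree with those of 1 + z or 1 - z, and a, b,
    c absorb the phases. *)
Lemma unitary2_parameters p q r s : let sq := @sqnorm R in
  sq p + sq q = 4 -> sq r + sq s = 4 -> sq p + sq r = 4 -> p * r^* + q * s^* = 0 ->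
  exists a b c z, [/\ a \in T, b \in T, c \in T & z \in T] /\
    [/\ p = a * (1 + z), q = a * c * (1 - z), r = b * (1 - z) & s = b * c * (1 + z)].
Proof.
move=> sq pq rs pr orth.
have p0 : 0 <= sq p := sqnorm_ge0 p; have q0 : 0 <= sq q := sqnorm_ge0 q.
(* Solves |1 + z|^2 = 2 + 2 t = |p|^2; 0 <= |p|^2 <= 4 gives |t| <= 1. *)
pose t := sq p / 2 - 1; pose z : R[i] := Complex t (Num.sqrt (1 - t ^+ 2)).
have zi : Num.sqrt (1 - t ^+ 2) ^+ 2 = 1 - t ^+ 2.
  by rewrite sqr_sqrtr// /t; nra.
have zT : z \in T by rewrite unit_circle_sqnorm /sqnorm /= zi addrC subrK.
have zp : sq p = sq (1 + z) by rewrite [RHS]/sqnorm /= add0r zi /t; field.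
have zq : sq q = sq (1 - z).
  by rewrite [RHS]/sqnorm /= sub0r sqrrN zi /t -[LHS](addKr (sq p)) pq; field.
have zr : sq r = sq (1 - z) by rewrite -zq; lra.
have zs : sq s = sq (1 + z) by rewrite -zp; lra.
have [a aT pE] := same_sqnorm zp; have [b bT rE] := same_sqnorm zr.
have sqT u v : u \in T -> sq (u * v) = sq v.
  by rewrite unit_circle_sqnorm /sq sqnormM => /eqP->; rewrite mul1r.
(* If q = 0 then z = 1 and c is free to match the phase of s. Otherwise q determines c, and
   orthogonality determines s. *)
have [q00|q00] := eqVneq q 0.
  have z1 : 1 - z = 0 by apply/eqP; rewrite -sqnorm_eq0 -/(sq _) -zq q00 /sq sqnorm0.
  have [c cT sE] : exists2 c, c \in T & s = c * (b * (1 + z)).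
    exact/same_sqnorm/(etrans zs)/esym/sqT.
  exists a, b, c, z; split=> //; split=> //; first by rewrite z1 mulr0.
  by rewrite sE; ring.
have [c cT qE] : exists2 c, c \in T & q = c * (a * (1 - z)).
  exact/same_sqnorm/(etrans zq)/esym/sqT.
exists a, b, c, z; split=> //; split=> //; first by rewrite qE; ring.
have q00' : q^* != 0 by rewrite conjC_eq0.
have := congr1 Num.conj orth; rewrite rmorphD !rmorphM rmorph0 /= !conjCK addrC.
move/eqP; rewrite addr_eq0 => /eqP qs; apply: (mulfI q00'); rewrite qs.
have /unit_circleP cc := cT.
rewrite pE rE qE !(rmorphM, rmorphB, rmorphD, rmorph1) /=.
have /unit_circleP zz := zT.
transitivity (c * c^* * a^* * b * ((1 - z^*) * (1 + z))); last by ring.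
by rewrite cc; ring: zz.
Qed.

End ThreeByThree.

(** Undoes the Fourier conjugation: each inner product F G collapses to the scalar k. *)
Lemma unsandwich (K : fieldType) n (k c : K) (L B P F G : 'M[K]_n) :
  F *m G = k%:M -> L *m F *m (c *: (G *m B *m F)) *m G *m P
    = (c * k ^+ 2) *: (L *m B *m P).
Proof.
move=> FG; rewrite -scalemxAr -!scalemxAl !mulmxA -(mulmxA L F G) FG.
rewrite -(mulmxA _ F G) FG !mul_mx_scalar -!scalemxAl scalerA.
by rewrite scalerA expr2 mulrA.
Qed.

(** * Reduction of a unitary matrix to the parametrised product *)

Section NormalForm.
Local Open Scope sesquilinear_scope.
Variables (R : realType) (A : 'M[R[i]]_3).
Local Notation T := (unit_circle R).
Hypothesis UA : scaled_unitary 1 A.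

(** The first two entries come from [unimodular_image]. The columns are orthonormal, so the image of
    (1, x, y) has squared norm 3, which leaves modulus 1 for the third. *)
Lemma unimodular_pair : exists x y : R[i], [/\ x \in T, y \in T &
  forall i, A i 0 + A i 1 * x + A i 2 * y \in T].
Proof.
have [[n1 n2 _] [o _ _]] := (scaled_unitary_rowP 1 A).1 UA.
have [x [y [xT yT h0 h1]]] := unimodular_image n1 n2 o.
exists x, y; split=> //; elim/ord3_ind => //; apply/unit_circleP.
have := scaled_unitary_adjoint (oner_neq0 _) UA; rewrite rmorph1 => /scaled_unitary_rowP.
rewrite !mxE !conjCK => -[[c0 c1 c2] [c01 c02 c12]].
pose D j k := (A 0 j)^* * A 0 k + (A 1 j)^* * A 1 k + (A 2 j)^* * A 2 k.
have DJ j k : D j k = 0 -> D k j = 0.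
  move=> h; have := congr1 Num.conj h; rewrite !(rmorphD, rmorphM, rmorph0) /= !conjCK.
  by move=> <-; rewrite /D; ring.
have c10 := DJ _ _ c01; have c20 := DJ _ _ c02; have c21 := DJ _ _ c12.
have /unit_circleP xx := xT; have /unit_circleP yy := yT.
have : (A 0 0 + A 0 1 * x + A 0 2 * y) * (A 0 0 + A 0 1 * x + A 0 2 * y)^*
   + (A 1 0 + A 1 1 * x + A 1 2 * y) * (A 1 0 + A 1 1 * x + A 1 2 * y)^*
   + (A 2 0 + A 2 1 * x + A 2 2 * y) * (A 2 0 + A 2 1 * x + A 2 2 * y)^* = 1 + 1 + 1.
  transitivity (D 0 0 + D 1 1 * (x * x^*) + D 2 2 * (y * y^*) + D 0 1 * x + D 1 0 * x^*
      + D 0 2 * y + D 2 0 * y^* + D 1 2 * (x^* * y) + D 2 1 * (x * y^*)).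
    by rewrite /D !(rmorphD, rmorphM) /=; ring.
  rewrite c10 c20 c21 xx yy [D 0 0]c0 [D 1 1]c1 [D 2 2]c2 [D 0 1]c01 [D 0 2]c02 [D 1 2]c12.
  by ring.
move: h0 h1 => /unit_circleP -> /unit_circleP ->.
exact: addrI.
Qed.

Lemma normal_form : exists a b c z l1 l2 l3 l4 l5 : R[i],
  [/\ [/\ a \in T, b \in T, c \in T & z \in T],
      [/\ l1 \in T, l2 \in T, l3 \in T, l4 \in T & l5 \in T] &
      A = 6^-1 *: (diag3 l1 l2 l3 *m fourier3J R *m core3 a b c z
                   *m fourier3 R *m diag3 1 l4 l5)].
Proof.
have [x [y [xT yT vT]]] := unimodular_pair.
pose v i := A i 0 + A i 1 * x + A i 2 * y.
have vJ i : (v i)^* \in T by rewrite unit_circle_conj; exact: vT.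
have vv i : v i * (v i)^* = 1 by apply/unit_circleP; exact: vT.
have /unit_circleP xx := xT; have /unit_circleP yy := yT.
pose B := diag3 (v 0)^* (v 1)^* (v 2)^* *m A *m diag3 1 x y.
(* The factor 2/3 turns the scale 9 of the Fourier conjugation into 4, as (2/3)^2 * 9 = 4, and
   cancels in [AM] as 6^-1 * (2/3) * 3^2 = 1. *)
pose M := (2 / 3) *: (fourier3 R *m B *m fourier3J R).
have UM : scaled_unitary 4 M.
  have -> : 4 = 2 / 3 * (2 / 3)^* * (3 * (1 * 1 * 1) * 3) :> R[i].
    rewrite (_ : (2 / 3)^* = 2 / 3); last by rewrite fmorph_div /= !rmorph_nat.
    by field.
  apply: scaled_unitaryZ; apply: scaled_unitaryM (fourier3J_unitary R).
  apply: scaled_unitaryM; first exact: fourier3_unitary.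
  apply: scaled_unitaryM; first apply: scaled_unitaryM => //; apply: diag3_unitary => //.
  exact: unit_circle1.
have AM : A = 6^-1 *: (diag3 (v 0) (v 1) (v 2) *m fourier3J R *m M
                   *m fourier3 R *m diag3 1 x^* y^*).
  rewrite /M (unsandwich _ _ _ _ (fourier3JK R)) /B !mulmxA.
  rewrite diag3M !vv diag3_1 mul1mx -mulmxA diag3M mulr1 xx yy diag3_1 mulmx1.
  by rewrite !scalerA (_ : _ * _ = 1) ?scale1r//; field.
have row1 i : B i 0 + B i 1 + B i 2 = 1.
  rewrite -(vv i) /B mulrC; move: i; elim/ord3_ind;
    rewrite !mxE !sum_ord3 !mxE !sum_ord3 !mxE /= /v; ring.
(* The corner is 2/3 times the sum of all entries of [B], whose three rows each sum to 1. *)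
have M00 : M 0 0 = 2.
  rewrite /M; move: row1; move: (B) => X row1.
  rewrite mxE mxE sum_ord3 ![(fourier3 R *m X) _ _]mxE !sum_ord3 !mxE /=.
  transitivity (2 / 3 * ((X 0 0 + X 0 1 + X 0 2) + (X 1 0 + X 1 1 + X 1 2)
    + (X 2 0 + X 2 1 + X 2 2))); first by ring.
  by rewrite !row1; field.
clearbody M.
have [[m0 m1 m2] [m01 m02 m12]] := (scaled_unitary_rowP 4 M).1 UM.
have := scaled_unitary_adjoint (_ : 4 != 0) UM; rewrite conjC_nat.
rewrite pnatr_eq0 => /(_ isT)/scaled_unitary_rowP.
rewrite !mxE !conjCK => -[[c0 c1 c2] _].
(* The corner 2 already exhausts the squared norm 4 of the first row and column, so their other
   entries vanish. *)
have zero2 (p q : R[i]) : 2 * 2^* + p * p^* + q * q^* = 4 -> p = 0 /\ q = 0.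
  rewrite conjC_nat -!sqnormC => h.
  have {}h : sqnorm p + sqnorm q = 0.
    apply: (@complexI R); rewrite rmorphD rmorph0; apply: (@addrI _ (2 * 2)).
    by rewrite /= addrA h; ring.
  by split; apply/eqP; rewrite -sqnorm_eq0; apply/eqP;
    have := sqnorm_ge0 p; have := sqnorm_ge0 q; lra.
rewrite M00 in m0 c0; have [M01 M02] := zero2 _ _ m0.
have [M10 M20] : M 1 0 = 0 /\ M 2 0 = 0.
  by apply: zero2; rewrite -c0 conjC_nat; ring.
have lift (p q : R[i]) : p * p^* + q * q^* = 4 -> sqnorm p + sqnorm q = 4.
  by move=> h; apply: (@complexI R); rewrite rmorphD rmorph_nat /= !sqnormC.
have [||||a [b [c [z [[aT bT cT zT] [pE qE rE sE]]]]]] :=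
  @unitary2_parameters R (M 1 1) (M 1 2) (M 2 1) (M 2 2).
- by apply: lift; rewrite -m1 M10; ring.
- by apply: lift; rewrite -m2 M20; ring.
- by apply: lift; rewrite -c1 M01 rmorph0; ring.
- by rewrite -m12 M10; ring.
exists a, b, c, z, (v 0), (v 1), (v 2), x^*, y^*; split; first by split.
  by split; rewrite ?unit_circle_conj//; exact: vT.
rewrite -(_ : M = core3 a b c z); first exact: AM.
by apply: matrix3P; split; rewrite mxE.
Qed.

End NormalForm.

Theorem corollary6p5 (R : realType) (A : 'M[R[i]]_3) :
  let T := unit_circle R in
  let w := omega R in
  A \is unitarymx <->
  exists a b c z l1 l2 l3 l4 l5 : R[i],
    [/\ [/\ a \in T, b \in T, c \in T & z \in T],
        [/\ l1 \in T, l2 \in T, l3 \in T, l4 \in T & l5 \in T] &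
        A = 6^-1 *:
          (mx3 [:: [:: l1; 0; 0];
                   [:: 0; l2; 0];
                   [:: 0; 0; l3]]
           *m mx3 [:: [:: 1; 1; 1];
                      [:: 1; w^*; w];
                      [:: 1; w; w^*]]
           *m mx3 [:: [:: 2; 0; 0];
                      [:: 0; a * (1 + z); a * c * (1 - z)];
                      [:: 0; b * (1 - z); b * c * (1 + z)]]
           *m mx3 [:: [:: 1; 1; 1];
                      [:: 1; w; w^*];
                      [:: 1; w^*; w]]
           *m mx3 [:: [:: 1; 0; 0];
                      [:: 0; l4; 0];
                      [:: 0; 0; l5]])].
Proof.
move=> T w; split=> [/unitarymxP UA|]; first exact: (normal_form UA).
case=> a [b [c [z [l1 [l2 [l3 [l4 [l5 [[aT bT cT zT] [T1 T2 T3 T4 T5] ->]]]]]]]]].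
(* The scales of the five factors multiply to 36, which the squared factor 1/6 cancels. *)
pose k : R[i] := 6^-1 * 6^-1^* * (1 * 3 * 4 * 3 * 1).
have k1 : k = 1 by rewrite /k fmorphV rmorph_nat; field.
apply/unitarymxP; rewrite -[in RHS]k1; apply: scaled_unitaryZ.
apply: scaled_unitaryM; last by apply: diag3_unitary => //; exact: unit_circle1.
apply: scaled_unitaryM (fourier3_unitary R).
apply: scaled_unitaryM (core3_unitary aT bT cT zT).
by apply: scaled_unitaryM (fourier3J_unitary R); exact: diag3_unitary.
Qed.
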